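(* Let $X=\{x_1,\ldots,x_n\}$ and let $R=\{x_jx_i=u_{ij}\mid 1\le i<j\le n\}$ be a set of quadratic relations satisfying conditions ( *1), ( *2), ( *3) given in the context. Then the semigroup $S=\langle X;R\rangle$ is of $I$-type.
   Context: Semigroups have a unit, $X$ is a set of $n$ distinct generators, and $\langle X;R\rangle$ denotes the semigroup with unit presented by generators $X$ and relations $R$. Conditions on $R=\{x_jx_i=u_{ij}\mid 1\le i<j\le n\}$: ( *1) For every $i<j$, $u_{ij}=x_{i'}x_{j'}$ with $i'<j'$ and $i'<j$. ( *2) As $(i,j)$ varies over the pairs with $i<j$, every pair $(i',j')$ with $i'<j'$ occurs exactly once. ( *3) The overlaps $x_kx_jx_i$ for $k>j>i$ do not give rise to new relations in $S$. That is, for the rewriting system $x_jx_i\to u_{ij}$ ($j>i$), the two ways of reducing $x_kx_jx_i$ (starting with $x_kx_j$ or starting with $x_jx_i$) lead to the same word of the form $x_ax_bx_c$, $a\le b\le c$. Equivalently, every element of $S$ is uniquely of the form $x_1^{a_1}\cdots x_n^{a_n}$ with $(a_1,\ldots,a_n)\in\mathbb{N}^n$. $I$-type: let $\mathcal{U}$ be the free commutative multiplicative semigroup (with unit) generated by $u_1,\ldots,u_n$. A semigroup $S$ generated by $X=\{x_1,\ldots,x_n\}$ is of (left) $I$-type if there is a bijection $v:\mathcal{U}\to S$ such that $v(1)=1$ and, for all $a\in\mathcal{U}$, $\{v(u_1a),\ldots,v(u_na)\}=\{x_1v(a),\ldots,x_nv(a)\}$. *)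

(* Defs.v *)
From HB Require Import structures.
From Stdlib Require Import Relation_Operators.
From mathcomp Require Import all_boot.
From mathcomp Require Import boolp classical_sets.
From mathcomp.multinomials Require Import monalg.

Set Implicit Arguments.
Unset Strict Implicit.
Unset Printing Implicit Defensive.

Local Open Scope quotient_scope.

(* "Semigroup" means semigroup with unit throughout, i.e. [monoidType]. *)

Section Presentation.
Variables (X : choiceType) (R : seq X -> seq X -> Prop).

Inductive rstep : seq X -> seq X -> Prop :=
  RStep p q l r of R l r : rstep (p ++ l ++ q) (p ++ r ++ q).

Definition reduces : seq X -> seq X -> Prop := clos_refl_trans _ rstep.

(* The monoid congruence on the free monoid [seq X] generated by [R]. *)
Definition pcong : seq X -> seq X -> Prop := clos_refl_sym_trans _ rstep.

Definition pcongb : rel (seq X) := fun s t => `[< pcong s t >].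

Lemma pcongb_refl : reflexive pcongb.
Proof. by move=> s; apply/asboolP; apply: rst_refl. Qed.

Lemma pcongb_sym : symmetric pcongb.
Proof. by move=> s t; apply/asboolP/asboolP; apply: rst_sym. Qed.

Lemma pcongb_trans : transitive pcongb.
Proof.
move=> t s r /asboolP st /asboolP tr.
by apply/asboolP; apply: rst_trans st tr.
Qed.

Canonical pcong_equiv := EquivRel pcongb pcongb_refl pcongb_sym pcongb_trans.

(* The monoid <X; R> of words modulo [pcong]. *)
Definition presented := {eq_quot pcong_equiv}.

HB.instance Definition _ := Choice.on presented.
HB.instance Definition _ := EqQuotient.on presented.

Lemma pcong_ctx p q s t : pcong s t -> pcong (p ++ s ++ q) (p ++ t ++ q).
Proof.
elim=> [_ _ [p' q' l r lr]|w|w w' _|w1 w2 w3 _ h1 _ h2].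
- have e z : p ++ (p' ++ z ++ q') ++ q = (p ++ p') ++ z ++ (q' ++ q).
    by rewrite !catA.
  by rewrite !e; apply: rst_step; apply: RStep.
- exact: rst_refl.
- exact: rst_sym.
- exact: rst_trans h1 h2.
Qed.

Lemma presentedP s t : \pi_presented s = \pi_presented t <-> pcong s t.
Proof. by split=> [/eqmodP/asboolP|st]; last by apply/eqmodP/asboolP. Qed.

Definition pone : presented := \pi_presented [::].

Definition pmul (a b : presented) : presented :=
  \pi_presented (repr a ++ repr b).

Definition pgen (x : X) : presented := \pi_presented [:: x].

Lemma pmul_pi s t :
  pmul (\pi_presented s) (\pi_presented t) = \pi_presented (s ++ t).
Proof.
apply/presentedP.
have h w : pcong (repr (\pi_presented w)) w by apply/presentedP; rewrite reprK.
apply: rst_trans (_ : pcong _ (s ++ repr (\pi_presented t))) _.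
  exact: (pcong_ctx [::] _ (h s)).
by have := pcong_ctx s [::] (h t); rewrite !cats0.
Qed.

Lemma pmulA : associative pmul.
Proof.
move=> a b c; rewrite -[a]reprK -[b]reprK -[c]reprK.
move: (repr a) (repr b) (repr c) => {a b c} s t r.
by rewrite (pmul_pi t r) (pmul_pi s t) (pmul_pi s) (pmul_pi _ r) catA.
Qed.

Lemma pmul1 : left_id pone pmul.
Proof. by move=> a; rewrite -[a]reprK (pmul_pi [::]). Qed.

Lemma pmulr1 : right_id pone pmul.
Proof. by move=> a; rewrite -[a]reprK (pmul_pi _ [::]) cats0. Qed.

HB.instance Definition _ := isMonoid.Build presented pmulA pmul1 pmulr1.

End Presentation.

Arguments presented {X} R.
Arguments pgen {X} R x.

Section QuadraticRelations.
Variables (n : nat) (u : 'I_n -> 'I_n -> seq 'I_n).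

(* R = {x_j x_i = u_ij | i < j}, oriented as rewriting rules x_j x_i -> u_ij.
   Only the values [u i j] with [i < j] matter. *)
Definition quad_rel (l r : seq 'I_n) : Prop :=
  exists i j : 'I_n, [/\ i < j, l = [:: j; i] & r = u i j].

Definition cond1 : Prop :=
  forall i j : 'I_n, i < j ->
  exists i' j' : 'I_n, [/\ u i j = [:: i'; j'], i' < j' & i' < j].

Definition cond2 : Prop :=
  forall i' j' : 'I_n, i' < j' ->
  exists! ij : 'I_n * 'I_n, ij.1 < ij.2 /\ u ij.1 ij.2 = [:: i'; j'].

(* Both words obtained from x_k x_j x_i by one step, on x_k x_j and on
   x_j x_i respectively, reduce to a common x_a x_b x_c with a <= b <= c. *)
Definition cond3 : Prop :=
  forall i j k : 'I_n, i < j -> j < k ->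
  exists a b c : 'I_n,
    [/\ a <= b, b <= c,
        reduces quad_rel (u j k ++ [:: i]) [:: a; b; c]
      & reduces quad_rel (k :: u i j) [:: a; b; c]].

End QuadraticRelations.

Section IType.
Variables (S : monoidType) (n : nat) (x : 'I_n -> S).

Definition generated_by : Prop :=
  forall s : S, exists w : seq 'I_n, s = (\prod_(i <- w) x i)%g.

(* [{cmonom 'I_n}] is the free commutative monoid on u_i = [ucm i]. *)
Definition left_Itype : Prop :=
  generated_by /\
  exists v : {cmonom 'I_n} -> S,
    [/\ bijective v,
        v mone = 1%g
      & forall a : {cmonom 'I_n},
          [set v (mmul (ucm i) a) | i in [set: 'I_n]]%classic =
          [set (x i * v a)%g | i in [set: 'I_n]]%classic].

End IType.

(* Main.v *)
Require Import Defs.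
From Stdlib Require Import Relation_Operators Operators_Properties.
From mathcomp Require Import all_boot finmap zify.
From mathcomp Require classical_sets.
From mathcomp.multinomials Require Import monalg.

Set Implicit Arguments.
Unset Strict Implicit.
Unset Printing Implicit Defensive.

(** Write a relation as x y = (L x y)(R x y), where the map
(x, y) |-> (L x y, R x y) is the involution of pairs of letters which fixes the
diagonal and exchanges a descent x_j x_i with the ascent u_ij.  The semigroup is
of I-type because of two properties of this involution:
- for every x the map y |-> R y x is a permutation of the letters ([R_inj]);
- pushing a letter x through a two-letter word y z and through the equal word
  (L y z)(R y z) makes the same letter come out on the right ([R_braid]).

Granting them, attach to a word the multiset of the letters that come out on
the right when each of its letters is pushed through the rest of the word
([content]).  The second property says that equal words have the same content.
The first one says that the contents of x_1 s, ..., x_n s are those of s with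
one letter added, each of the n letters being added once; hence every multiset
is a content.  Moreover a letter of the content of s can be
brought to the right end of s ([content_last]) and then cancelled, so words with
equal contents are equal in the semigroup.  Thus the content is a bijection onto
the free commutative semigroup, and its inverse is the required v.

Both properties are proved by studying the classes of three-letter words under
the relations.  Each class contains exactly one nondecreasing word, by
confluence, and exactly one nonincreasing word, by counting
([nonincr_unique]).  A parity argument then shows that, in a class containing a
word x x y or x y y, both of these extremal words contain such a repetition
([repeats_class]).  Consequently no strictly monotone word occurs in such a
class, and this yields inequalities such as R x (L x y) <= R x y for x < y
([R_square]).  The heart of the proof is that equality holds in the latter
([all_stable]), by induction on the letter R x y: a strict inequality
would give a class x x y whose nonincreasing word ends in a smaller letter, and
the induction hypothesis identifies that class as one with another nondecreasing
word.  Equality makes y |-> R y x a permutation.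

For the second property, classes are counted.  Since y |-> R y x is a
permutation, a class has at least as many words as there are rearrangements of
its nondecreasing word: 1, 3 or 6.  Both sides add up to n ^ 3, so there is
equality everywhere ([card_class]), and the possible shapes of classes with 3 or
6 words give [R_braid]. *)

(** * Finite sets and involutions *)

Lemma surj_on_set (T : finType) (A : {set T}) (f : T -> T) :
  A \subset f @: A -> {in A, forall x, f x \in A} /\ {in A &, injective f}.
Proof.
move=> sA; have eA : A = f @: A.
  by apply/eqP; rewrite eqEcard sA leq_imset_card.
split; first by move=> x xA; rewrite eA imset_f.
by apply/imset_injP; rewrite -eA.
Qed.

Lemma odd_card_fixed (T : finType) (f : T -> T) (C : {set T}) :
    involutive f -> {in C, forall t, f t \in C} ->
  odd #|[set t in C | f t == t]| = odd #|C|.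
Proof.
move=> fK; have [m] := ubnP #|C|; elim: m C => // m IH C leC fC.
have [/forall_inP allfix | ] := boolP [forall t in C, f t == t].
  by congr (odd #|pred_of_set _|); apply/setP=> t; rewrite inE;
     case tC: (t \in C); rewrite //= allfix.
rewrite negb_forall => /existsP[t]; rewrite negb_imply => /andP[tC nft].
have fD : {in C :\ t :\ f t, forall s, f s \in C :\ t :\ f t}.
  move=> s; rewrite !inE => /and3P[s1 s2 sC].
  by rewrite (inj_eq (inv_inj fK)) s2 -{1}(fK t) (inj_eq (inv_inj fK)) s1 fC.
have cardC : #|C| = #|C :\ t :\ f t|.+2.
  by rewrite (cardsD1 t) tC (cardsD1 (f t) (C :\ t)) !inE nft fC.
have ltD : #|C :\ t :\ f t| < m by rewrite cardC in leC; apply: ltnW.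
rewrite cardC /= negbK -(IH (C :\ t :\ f t)) //.
congr (odd #|pred_of_set _|); apply/setP=> s; rewrite !inE.
have [-> | _] := eqVneq s (f t); first by rewrite fK eq_sym (negPf nft) andbF.
by have [-> | _] := eqVneq s t; first by rewrite (negPf nft) andbF.
Qed.

(** * The involution on pairs of letters and its action on triples *)

(** The conclusion of [lower_L] is the inequality i' < j of the relations
x_j x_i = x_i' x_j'; the last two fields say that descents and ascents are
exchanged. *)
Record ordered_involution n (L R : 'I_n -> 'I_n -> 'I_n) : Prop := {
  inv_L : forall x y, L (L x y) (R x y) = x;
  inv_R : forall x y, R (L x y) (R x y) = y;
  diag_L : forall x, L x x = x;
  diag_R : forall x, R x x = x;
  lower_L : forall x y : 'I_n, y < x -> L x y < x;
  descent_LR : forall x y : 'I_n, y < x -> L x y < R x y;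
  ascent_LR : forall x y : 'I_n, x < y -> R x y < L x y
}.

Section OrderedInvolution.

Variables (n : nat) (L R : 'I_n -> 'I_n -> 'I_n).
Hypothesis LR : ordered_involution L R.

Let LK := inv_L LR.
Let RK := inv_R LR.
Let Lid := diag_L LR.
Let Rid := diag_R LR.
Let L_lt := lower_L LR.
Let descent := descent_LR LR.
Let ascent := ascent_LR LR.

Lemma L_gt (x y : 'I_n) : x < y -> x < L x y.
Proof. by move/ascent/L_lt; rewrite LK. Qed.

Lemma L_eq (x y : 'I_n) : (L x y == x) = (x == y).
Proof.
apply/eqP/eqP => [e | <-]; last exact: Lid.
apply/val_inj/eqP; rewrite eqn_leq; apply/andP; split; rewrite leqNgt.
  by apply/negP=> /L_lt; rewrite e ltnn.
by apply/negP=> /L_gt; rewrite e ltnn.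
Qed.

Lemma LR_eq (x y : 'I_n) : (L x y == R x y) = (x == y).
Proof.
apply/eqP/eqP => [e | <-]; last by rewrite Lid Rid.
have h1 := LK x y; have h2 := RK x y.
by rewrite e Lid in h1; rewrite e Rid in h2; exact: etrans (esym h1) h2.
Qed.

Definition word3 : Type := 'I_n * 'I_n * 'I_n.

Definition r12 (t : word3) : word3 :=
  let: (x, y, z) := t in (L x y, R x y, z).
Definition r23 (t : word3) : word3 :=
  let: (x, y, z) := t in (x, L y z, R y z).
Definition nondecr (t : word3) := let: (x, y, z) := t in x <= y <= z.
Definition nonincr (t : word3) := let: (x, y, z) := t in z <= y <= x.
Definition repeats (t : word3) := let: (x, y, z) := t in (x == y) || (y == z).

Lemma r12K : involutive r12.
Proof. by case=> [[x y] z] /=; rewrite LK RK. Qed.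

Lemma r23K : involutive r23.
Proof. by case=> [[x y] z] /=; rewrite LK RK. Qed.

Lemma r12_fix x y z : (r12 (x, y, z) == (x, y, z)) = (x == y).
Proof.
rewrite /= !xpair_eqE L_eq eqxx andbT.
by case: eqVneq => //= <-; rewrite Rid eqxx.
Qed.

Lemma r23_fix x y z : (r23 (x, y, z) == (x, y, z)) = (y == z).
Proof.
rewrite /= !xpair_eqE L_eq eqxx /=.
by case: eqVneq => //= <-; rewrite Rid eqxx.
Qed.

Lemma repeats_monotone t : repeats t -> nondecr t || nonincr t.
Proof. case: t => [[x y] z] /=; rewrite -!val_eqE /=; lia. Qed.

(** The weight of the first two letters, in base n: an increase of the first
letter outweighs any change of the second one. *)
Definition rank (t : word3) : nat := let: (x, y, _) := t in x * n + y.

Lemma rank_bound t : rank t < n * n.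
Proof.
case: t => [[x y] z] /=.
apply: (@leq_trans (x.+1 * n)); last by rewrite leq_mul2r ltn_ord orbT.
by rewrite mulSn addnC ltn_add2r.
Qed.

Lemma rank_lex (x x' y y' z z' : 'I_n) :
  x < x' -> rank (x, y, z) < rank (x', y', z').
Proof.
move=> lt; have : x.+1 * n <= x' * n by rewrite leq_mul2r lt orbT.
by rewrite mulSn /=; have := ltn_ord y; lia.
Qed.

(** Turning ascents into descents raises [rank], so it ends at a nonincreasing
word.  The lemma returns the word just before the end together with the last
move, with any property [P] that the moves preserve. *)
Lemma climb (P : word3 -> Prop) :
    (forall x y z : 'I_n, x < y -> P (x, y, z) -> P (r12 (x, y, z))) ->
    (forall x y z : 'I_n, y < z -> P (x, y, z) -> P (r23 (x, y, z))) ->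
  forall t, P t -> ~~ nonincr t -> exists x y z : 'I_n, P (x, y, z) /\
    (x < y /\ nonincr (r12 (x, y, z)) \/ y < z /\ nonincr (r23 (x, y, z))).
Proof.
move=> P12 P23 t; have [m] := ubnP (n * n - rank t).
elim: m t => // m IH [[x y] z] le_m Pt nt.
have [xy | yx] := ltnP x y.
  have [nt' | nt'] := boolP (nonincr (r12 (x, y, z))).
    by exists x, y, z; split=> //; left.
  apply: (IH _ _ (P12 _ _ _ xy Pt) nt').
  have : rank (x, y, z) < rank (r12 (x, y, z)) by exact/rank_lex/L_gt.
  by have := rank_bound (r12 (x, y, z)); lia.
have yz : y < z by move: nt; rewrite /= yx andbT -ltnNge.
have [nt' | nt'] := boolP (nonincr (r23 (x, y, z))).
  by exists x, y, z; split=> //; right.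
apply: (IH _ _ (P23 _ _ _ yz Pt) nt').
have : rank (x, y, z) < rank (r23 (x, y, z)).
  by rewrite /= ltn_add2l; exact: L_gt.
by have := rank_bound (r23 (x, y, z)); lia.
Qed.

(** * Classes of three-letter words *)

(** Two words belong to the same class when [nf] agrees on them; the value is then
the only nondecreasing word of the class. *)
Record normal_form (nf : word3 -> word3) : Prop := {
  nf_sorted : forall t, nondecr (nf t);
  nf_fixed : forall t, nondecr t -> nf t = t;
  nf_r12 : forall t, nf (r12 t) = nf t;
  nf_r23 : forall t, nf (r23 t) = nf t
}.

Inductive descends : word3 -> word3 -> Prop :=
| Descends12 (x y z : 'I_n) of y < x : descends (x, y, z) (r12 (x, y, z))
| Descends23 (x y z : 'I_n) of z < y : descends (x, y, z) (r23 (x, y, z)).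

(** Only the words x y z with x > y > z have two reducible places. *)
Definition confluent := forall x y z : 'I_n, z < y -> y < x ->
  exists m, [/\ nondecr m, clos_refl_trans _ descends (r12 (x, y, z)) m
                        & clos_refl_trans _ descends (r23 (x, y, z)) m].

Lemma rank_descends s t : descends s t -> rank t < rank s.
Proof.
case=> x y z lt; first exact/rank_lex/L_lt.
by rewrite /= ltn_add2l; exact: L_lt.
Qed.

(** The leftmost reduction, iterated, is constant on classes: by induction on
[rank], because confluence compares the two reductions of a strictly decreasing
word. *)
Lemma normal_form_exists : confluent -> exists nf, normal_form nf.
Proof.
move=> conf.
pose step (t : word3) : word3 := let: (x, y, z) := t in
  if y < x then r12 t else if z < y then r23 t else t.
have step_fix t : nondecr t -> step t = t.
  by case: t => [[x y] z] /= /andP[xy yz]; rewrite !ltnNge xy yz.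
have step_desc t : ~~ nondecr t -> descends t (step t).
  case: t => [[x y] z]; rewrite /= negb_and -!ltnNge.
  by case: ifP => [yx _ | _ /= zy]; [constructor | rewrite zy; constructor].
have iter_nondecr k t : rank t <= k -> nondecr (iter k step t).
  elim: k t => [|k IH] t le_k.
    by apply: contraTT le_k => /step_desc/rank_descends; rewrite -ltnNge; apply: leq_ltn_trans.
  rewrite iterSr; have [nd | /step_desc/rank_descends lt] := boolP (nondecr t).
    by rewrite step_fix // iter_fix // step_fix.
  by apply: IH; rewrite -ltnS (leq_trans lt).
pose nf := iter (n * n) step.
have nd t : nondecr (nf t) by apply/iter_nondecr/ltnW/rank_bound.
have nf_step t : nf (step t) = nf t by rewrite /nf -iterSr iterS step_fix ?nd.
have nf_desc s t : descends s t -> nf t = nf s.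
  have [k] := ubnP (rank s); elim: k s t => // k IH s t le_k st.
  have IHs s' m : clos_refl_trans _ descends s' m -> rank s' < k -> nf m = nf s'.
    move=> ch; elim: (clos_rt_rt1n _ _ _ _ ch) => // a b c ab _ IHc lt_k.
    rewrite IHc ?(IH _ _ _ ab) //; exact: ltn_trans (rank_descends ab) lt_k.
  case: st le_k => x y z lt le_k.
    by rewrite -[RHS]nf_step /= lt.
  have [yx | xy] := ltnP y x; last by rewrite -[RHS]nf_step /= ltnNge xy lt.
  have [m [_ m12 m23]] := conf _ _ _ lt yx.
  have lt12 := leq_trans (rank_descends (Descends12 z yx)) le_k.
  have lt23 := leq_trans (rank_descends (Descends23 x lt)) le_k.
  rewrite -(IHs _ _ m23) // (IHs _ _ m12) //.
  by rewrite -[RHS]nf_step /= yx.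
exists nf; split=> // [t ndt | [[x y] z] | [[x y] z]].
- by rewrite /nf iter_fix // step_fix.
- have [lt | lt | /val_inj ->] := ltngtP x y; last by rewrite /= Lid Rid.
    by rewrite -{2}[(x, y, z)]r12K; apply/esym/nf_desc; constructor; exact: ascent.
  by apply: nf_desc; constructor.
have [lt | lt | /val_inj ->] := ltngtP y z; last by rewrite /= Lid Rid.
  by rewrite -{2}[(x, y, z)]r23K; apply/esym/nf_desc; constructor; exact: ascent.
by apply: nf_desc; constructor.
Qed.

Section NormalForm.

Variable nf : word3 -> word3.
Hypothesis nfP : normal_form nf.

Let nf_nondecr := nf_sorted nfP.
Let nf_id := nf_fixed nfP.
Let nf12 := nf_r12 nfP.
Let nf23 := nf_r23 nfP.

Lemma nonincr_in_class t : exists2 s, nonincr s & nf s = nf t.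
Proof.
have [? | nt] := boolP (nonincr t); first by exists t.
have [|||x [y [z [<- [[_ ?]|[_ ?]]]]]] := @climb (fun s => nf s = nf t) _ _ t _ nt.
- by move=> x y z _; rewrite nf12.
- by move=> x y z _; rewrite nf23.
- by [].
- by exists (r12 (x, y, z)); rewrite ?nf12.
- by exists (r23 (x, y, z)); rewrite ?nf23.
Qed.

(** Reversal of words shows that there are as many nonincreasing words as
nondecreasing ones, and [nf] maps the former onto the latter, hence
bijectively. *)
Lemma nonincr_unique s t : nonincr s -> nonincr t -> nf s = nf t -> s = t.
Proof.
pose A := [set s | nonincr s]; pose B := [set s | nondecr s].
pose flip (t : word3) : word3 := let: (x, y, z) := t in (z, y, x).
have flipK : involutive flip by case=> [[x y] z].
have cAB : #|A| = #|B|.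
  rewrite -(card_imset _ (inv_inj flipK)); congr #|pred_of_set _|.
  apply/setP=> -[[x y] z]; rewrite inE; apply/imsetP/idP.
    by move=> [[[x' y'] z']]; rewrite inE => ? [-> -> ->].
  by move=> ?; exists (z, y, x) => //; rewrite inE.
have imA : nf @: A = B.
  apply/setP=> m; rewrite inE; apply/imsetP/idP => [[w _ ->] // | hm].
  have [w wi e] := nonincr_in_class m.
  by exists w; rewrite ?inE // e nf_id.
have /imset_injP inj : #|nf @: A| == #|A| by rewrite imA cAB.
by move=> si ti; apply: inj; rewrite inE.
Qed.

(** [r12] and [r23] act on a class as involutions whose fixed points are the words
x x y and y x x respectively.  Both numbers of fixed points have the parity of
the class, so a class containing such a word contains two of them, or a word
x x x.  These words are monotone, so they are the nondecreasing and the
nonincreasing word of the class. *)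
Lemma repeats_class s t :
  repeats s -> nf t = nf s -> nondecr t || nonincr t -> repeats t.
Proof.
move=> rs ets mt.
pose C := [set w | nf w == nf s].
pose E1 := [set w in C | r12 w == w]; pose E2 := [set w in C | r23 w == w].
have odd12 : odd #|E1| = odd #|E2|.
  by rewrite (odd_card_fixed r12K) ?(odd_card_fixed r23K) // => w;
     rewrite !inE ?nf12 ?nf23.
have inE1 x y z : ((x, y, z) \in E1) = (nf (x, y, z) == nf s) && (x == y).
  by rewrite !inE r12_fix.
have inE2 x y z : ((x, y, z) \in E2) = (nf (x, y, z) == nf s) && (y == z).
  by rewrite !inE r23_fix.
have repE w : w \in E1 :|: E2 -> repeats w /\ nf w = nf s.
  case: w => [[x y] z]; rewrite inE inE1 inE2 /=.
  by case/orP=> /andP[/eqP-> ->]; rewrite ?orbT.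
have sE : s \in E1 :|: E2.
  move: rs; case: (s) inE1 inE2 => [[x y] z] inE1 inE2.
  by rewrite /= inE inE1 inE2 eqxx.
have [sE12 | [s' [s'E ne]]] :
    (s \in E1) && (s \in E2) \/ exists s', s' \in E1 :|: E2 /\ s' != s.
  have [_ | sE12] := boolP ((s \in E1) && (s \in E2)); first by left.
  right; have [big | small] := boolP [exists s' in E1 :|: E2, s' != s].
    by have /exists_inP[s' ? ?] := big; exists s'.
  exfalso; have only w : w \in E1 :|: E2 -> w = s.
    move=> wE; apply/eqP; apply: contraNT small => ne.
    by apply/exists_inP; exists w.
  have cardE (E : {set word3}) : E \subset E1 :|: E2 -> #|E| = (s \in E).
    move=> /subsetP sub; have [sE' | sE'] := boolP (s \in E).
      rewrite /= -(cards1 s); congr #|pred_of_set _|; apply/setP=> w; rewrite inE.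
      by apply/idP/eqP => [/sub/only | ->].
    apply/eqP; rewrite cards_eq0 -subset0; apply/subsetP=> w wE.
    by rewrite -(only w (sub w wE)) wE in sE'.
  move: odd12 sE sE12; rewrite !cardE ?subsetUl ?subsetUr // in_setU.
  by case: (s \in E1); case: (s \in E2).
- have : s = t.
    move: sE12 ets mt; case: (s) inE1 inE2 => [[x y] z] inE1 inE2.
    rewrite inE1 inE2 eqxx /= => /andP[/eqP <- /eqP <-] e.
    have nd : nondecr (x, x, x) by rewrite /= leqnn.
    case/orP=> mt; last by apply: nonincr_unique; rewrite //= leqnn.
    by rewrite -(nf_id nd) -e nf_id.
  by move=> <-.
have [rs' es'] := repE _ s'E.
have dcase w w' : nondecr w -> nondecr w' -> nf w = nf w' -> w = w'.
  by move=> dw dw'; rewrite !nf_id.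
case/orP: mt => mt; case/orP: (repeats_monotone rs) => ms;
  case/orP: (repeats_monotone rs') => ms'.
all: try by rewrite (dcase t s).
all: try by rewrite (dcase t s') // es'.
all: try by rewrite (nonincr_unique mt ms).
all: try by rewrite (nonincr_unique mt ms') // es'.
all: case/eqP: ne.
all: by [apply: dcase | apply: nonincr_unique].
Qed.

Lemma repeats_link s t :
  repeats s -> nf t = nf s -> ~~ repeats t -> ~~ nondecr t /\ ~~ nonincr t.
Proof.
move=> rs e nt; apply/andP; rewrite -negb_or; apply: contra nt.
exact: repeats_class e.
Qed.

(** Otherwise the class of x x y would contain the strictly decreasing word
obtained from it by [r23] and then [r12]. *)
Lemma R_square (x y : 'I_n) : x < y -> R x (L x y) <= R x y.
Proof.
move=> xy; have xp := L_gt xy; set p := L x y in xp *.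
have e : nf (L x p, R x p, R x y) = nf (x, x, y).
  by rewrite -(nf23 (x, x, y)) -(nf12 (r23 _)).
rewrite leqNgt; apply/negP=> lt.
have lt' := ascent xp.
have rep : repeats (x, x, y) by rewrite /= eqxx.
have nr : ~~ repeats (L x p, R x p, R x y) by rewrite /= -!val_eqE /=; lia.
by have [_ /negP[]] := repeats_link rep e nr; rewrite /=; lia.
Qed.

(** Otherwise the class of y x x would contain the strictly decreasing word
obtained from it by [r12] and then [r23]. *)
Lemma L_square (x y : 'I_n) :
  y < x -> R y x < x -> L y x <= L (R y x) x.
Proof.
move=> yx tx; have lt' := ascent tx; set t := R y x in tx lt' *.
have e : nf (L y x, L t x, R t x) = nf (y, x, x).
  by rewrite -(nf12 (y, x, x)) -(nf23 (r12 _)).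
rewrite leqNgt; apply/negP=> lt.
have rep : repeats (y, x, x) by rewrite /= eqxx orbT.
have nr : ~~ repeats (L y x, L t x, R t x) by rewrite /= -!val_eqE /=; lia.
by have [_ /negP[]] := repeats_link rep e nr; rewrite /=; lia.
Qed.

(** * The maps y |-> R y x are permutations *)

(** For a < b the moves [r23] and [r12] lead from a a b to (w, R a (L a b), R a b)
with w = L a (L a b); stability of R a b says that this word ends in a
repetition, so that the class of a a b consists of these three words. *)
Definition stable x :=
  forall a b : 'I_n, a < b -> R a b = x -> R a (L a b) = x.

(** The witness is w = L a b with a = L b x. *)
Lemma stable_above (x b : 'I_n) : stable x -> x < b ->
  exists w : 'I_n, [/\ x < w, R w x = b & L w x = L b x].
Proof.
move=> gx xb; set a := L b x.
have ab : a < b by exact: L_lt.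
have Rab : R a b = x by rewrite -{1}(LK b x) gx ?RK ?descent.
exists (L a b); rewrite -{2 3}Rab LK RK; split=> //.
by rewrite -{1}Rab ascent.
Qed.

Lemma stable_high (x v : 'I_n) : stable x -> x < v ->
  x < R v x /\ L (R v x) x = L v x.
Proof.
move=> gx xv; pose B := [set w : 'I_n | x < w].
have [|Bf inj] := @surj_on_set _ B (R^~ x).
  apply/subsetP=> b; rewrite inE => /(stable_above gx)[w [xw Rw _]].
  by apply/imsetP; exists w; rewrite ?inE.
have vB : v \in B by rewrite inE.
have := Bf v vB; rewrite inE => fv; split=> //.
have [w [xw Rw <-]] := stable_above gx fv.
by congr (L _ x); apply: inj; rewrite ?inE.
Qed.

(** Surjectivity of y |-> R y x on the letters below x comes from
[stable_above] at each x0 < x, with b = x; so this map permutes these letters.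
By [L_square], L y x does not decrease when y is replaced by R y x; as both
families of values have the same sum over the permuted letters, it does not
change. *)
Lemma stable_low (x : 'I_n) : (forall x0 : 'I_n, x0 < x -> stable x0) ->
  (forall e : 'I_n, e < x -> R e x < x) /\
  forall e : 'I_n, e < x ->
    exists y : 'I_n, [/\ y < x, R y x = e & L y x = L e x].
Proof.
move=> IH; pose A := [set a : 'I_n | a < x].
have [|Af inj] := @surj_on_set _ A (R^~ x).
  apply/subsetP=> x0; rewrite inE => lt0.
  have [w [xw Rw _]] := stable_above (IH x0 lt0) lt0.
  apply/imsetP; exists (L w x0); last by rewrite /= -Rw RK.
  by rewrite inE -Rw descent.
have Rlt (e : 'I_n) : e < x -> R e x < x by move=> ex; have := Af e; rewrite !inE; apply.
split=> // e ex.
have imA : (R^~ x) @: A = A.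
  apply/eqP; rewrite eqEcard card_in_imset // leqnn andbT.
  by apply/subsetP=> _ /imsetP[a aA ->]; exact: Af.
have eqL : forall a : 'I_n, a < x -> L (R a x) x = L a x.
  move=> a ax; apply/val_inj/esym/eqP.
  have := @leqif_sum _ (fun i => i \in A) (fun i => L i x == L (R i x) x)
    (fun i => L i x : nat) (fun i => L (R i x) x : nat).
  case=> [i|_].
    by rewrite inE => ix; split; [exact: L_square (Rlt _ ix) | by rewrite val_eqE].
  rewrite -[X in _ == X](big_imset (fun i => L i x : nat) inj) imA eqxx.
  by move/esym/forall_inP/(_ a); rewrite inE => /(_ ax).
have : e \in (R^~ x) @: A by rewrite imA inE.
by case/imsetP=> a; rewrite inE => ax -> ; exists a; rewrite eqL.
Qed.

(** Induction on x.  If R a b = x but R a (L a b) < x, then climb from the word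
(w, R a (L a b), x) of the class of a a b to the nonincreasing word of the class.
The latter has the shape v p p or v v p by [repeats_class].  In the first case
p < x is stable; in the second case [stable_low] applies to the last letter of
the preceding word.  Either way one more move produces a nondecreasing word of the
class, and it is not a a b. *)
Lemma all_stable (x : 'I_n) : stable x.
Proof.
have [m] := ubnP x; elim: m x => // m IHm x; rewrite ltnS => xm.
have IH (x0 : 'I_n) : x0 < x -> stable x0 by move=> lt0; apply: IHm; apply: leq_trans xm.
move=> a b ab Rab; apply/val_inj/eqP; rewrite eqn_leq.
have -> : R a (L a b) <= x by rewrite -[in X in _ <= X]Rab R_square.
rewrite leqNgt; apply/negP; set y := L a b; set x' := R a y => x'x.
have ay : a < y by exact: L_gt.
set w := L a y; have x'w : x' < w by exact: ascent.
have xw : nf (w, x', x) = nf (a, a, b).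
  by rewrite -(nf23 (a, a, b)) -(nf12 (r23 _)) /= Rab.
(* At the starting word the last letter is x, and the first two letters form a
   descent; a move by r23 brings the last letter below x.  So the last letter is
   below x whenever r12 is the next move. *)
pose P (t : word3) := [/\ nf t = nf (a, a, b), t.2 <= x &
  (t.2 < x) || (t.1.2 <= t.1.1)].
have rep : repeats (a, a, b) by rewrite /= eqxx.
have nd : nondecr (a, a, b) by rewrite /= leqnn ltnW.
have normal t : nondecr t -> nf t = nf (a, a, b) -> t = (a, a, b).
  by move=> dt; rewrite !nf_id.
have low (z : 'I_n) : z <= x -> forall x0 : 'I_n, x0 < z -> stable x0.
  by move=> zx x0 lt0; apply: IH; apply: leq_trans zx.
have [||||c [e [f [[ef fx side] last_step]]]] := @climb P _ _ (w, x', x).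
- move=> c e f ce [ecl /= fx]; rewrite [e <= c]leqNgt ce orbF => fx'.
  by split; [rewrite -ecl -(nf12 (c, e, f)) | | rewrite /= fx'].
- move=> c e f ef [ecl /= fx _].
  have lt : R e f < x by apply: leq_trans (fx); exact: (stable_low (low f fx)).1.
  by split; [rewrite -ecl -(nf23 (c, e, f)) | exact: ltnW | rewrite /= lt].
- by split; rewrite //= (ltnW x'w) orbT.
- by rewrite /= [x <= x']leqNgt x'x.
case: last_step => [[ce ni] | [lef ni]].
  (* The last move is r12: the nonincreasing word is (L c e, f, f). *)
  have := repeats_class rep; rewrite -{1}ef -nf12.
  move=> /(_ _ erefl); rewrite ni orbT => /(_ isT) /=.
  rewrite LR_eq -val_eqE (ltn_eqF ce) /= => /eqP Rf.
  have fx' : f < x by move: side; rewrite /= [e <= c]leqNgt ce orbF.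
  have fv : f < L c e by rewrite -Rf ascent.
  have [fe Le] := stable_high (IH _ fx') fv.
  have Re : R (L c e) f = e by rewrite -Rf RK.
  have Lc : L (L c e) f = c by rewrite -Rf LK.
  rewrite Re Lc in fe Le.
  have := normal (c, L e f, R e f); rewrite /= Le leqnn.
  rewrite -{1}Le (ltnW (descent fe)) -ef -(nf23 (c, e, f)) /= Le.
  case/(_ isT erefl) => ca _ Rb.
  have xf : x = f by rewrite -Rab -Rb -ca -Le RK.
  by rewrite xf ltnn in fx'.
(* The last move is r23: the nonincreasing word is (c, c, R e f). *)
have [y0 [y0f Ry0 Ly0]] := (stable_low (low f fx)).2 e lef.
have := repeats_class rep; rewrite -{1}ef -nf23.
move=> /(_ _ erefl); rewrite ni orbT => /(_ isT) /=.
rewrite LR_eq -[e == f]val_eqE (ltn_eqF lef) orbF => /eqP cL.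
have := normal (y0, f, f); rewrite /= leqnn (ltnW y0f) -ef.
rewrite -(nf12 (y0, f, f)) /= Ry0 Ly0 -cL => /(_ isT erefl) [ya fa _].
by rewrite ya fa ltnn in y0f.
Qed.

Lemma R_surj (x e : 'I_n) : exists y, R y x = e.
Proof.
have [ex | xe | /val_inj ->] := ltngtP e x; last by exists x.
  have [_ /(_ e ex)[y [_ Ry _]]] := @stable_low x (fun x0 _ => @all_stable x0).
  by exists y.
by have [y [_ Ry _]] := stable_above (@all_stable x) xe; exists y.
Qed.

Lemma R_inj x : injective (R^~ x).
Proof.
have [|_ inj] := @surj_on_set _ [set: 'I_n] (R^~ x).
  apply/subsetP=> e _; have [y <-] := R_surj x e.
  by apply/imsetP; exists y.
by move=> y z; apply: inj; rewrite inE.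
Qed.

Lemma R_eq x y : (R y x == x) = (y == x).
Proof. by rewrite -{2}(Rid x) (inj_eq (@R_inj x)). Qed.

(** * Counting the words of a class *)

Definition class t := [set s | nf s == nf t].

Lemma class_nonrep t s : ~~ repeats (nf t) -> s \in class t -> ~~ repeats s.
Proof.
move=> nr; rewrite inE => /eqP e; apply: contra nr => rs.
rewrite -e; apply: (repeats_class rs); last by rewrite nf_nondecr.
by rewrite (nf_id (nf_nondecr s)).
Qed.

Lemma class12 t s : (r12 s \in class t) = (s \in class t).
Proof. by rewrite !inE nf12. Qed.

Lemma class23 t s : (r23 s \in class t) = (s \in class t).
Proof. by rewrite !inE nf23. Qed.

(** Without repetitions in the class, [r12] has no fixed point there, and it
preserves the last letter. *)
Lemma card_tails t : ~~ repeats (nf t) ->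
  2 * #|(fun s : word3 => s.2) @: class t| <= #|class t|.
Proof.
move=> nr; rewrite -[leqRHS]sum1_card (partition_big_imset (fun s : word3 => s.2)).
rewrite mulnC -sum_nat_const; apply: leq_sum => z /imsetP[[[x y] z'] st /= ->].
rewrite sum1_card; apply/card_gt1P; exists (x, y, z'), (r12 (x, y, z')).
have st12 : r12 (x, y, z') \in class t by rewrite class12.
split; first by rewrite unfold_in /= st eqxx.
  by apply/andP; split.
have := class_nonrep nr st; rewrite [repeats _]/= negb_or => /andP[xy _].
by rewrite eq_sym r12_fix.
Qed.

Lemma tails_uniq t x y z : ~~ repeats (nf t) -> (x, y, z) \in class t ->
  uniq [:: z; R y z; R (R x y) z].
Proof.
move=> nr st; have := class_nonrep nr st; rewrite /= negb_or => /andP[xy yz].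
have := st; rewrite -class12 => /(class_nonrep nr); rewrite /= negb_or.
case/andP=> _ yz'; rewrite !inE negb_or !andbT (inj_eq (@R_inj z)).
by rewrite ![z == _]eq_sym [y == _]eq_sym !R_eq yz yz' xy.
Qed.

Lemma three_words t (f g : word3 -> word3) : involutive f ->
  f t = t -> g t != t -> f (g t) != g t -> uniq [:: t; g t; f (g t)].
Proof.
move=> fK ft gt fgt; rewrite /= !inE negb_or eq_sym gt eq_sym /=.
by rewrite [g t == _]eq_sym fgt -{2}ft (inj_eq (inv_inj fK)) gt.
Qed.

Lemma card_class_repeats x y z : repeats (x, y, z) ->
  (x != y) || (y != z) -> 3 <= #|class (x, y, z)|.
Proof.
rewrite /=; have [<- _ /= yz | xy /= /eqP<- _] := eqVneq x y; apply/card_geqP.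
  exists [:: (x, x, z); r23 (x, x, z); r12 (r23 (x, x, z))]; split=> //.
    apply: (three_words r12K); rewrite ?r23_fix //; first by apply/eqP; rewrite r12_fix.
    by rewrite [r23 _]/= r12_fix eq_sym L_eq.
  by move=> w; rewrite !in_cons in_nil orbF => /or3P[]/eqP->;
     rewrite inE ?nf12 ?nf23.
exists [:: (x, y, y); r12 (x, y, y); r23 (r12 (x, y, y))]; split=> //.
  apply: (three_words r23K); rewrite ?r12_fix //; first by apply/eqP; rewrite r23_fix.
  by rewrite [r12 _]/= r23_fix R_eq.
by move=> w; rewrite !in_cons in_nil orbF => /or3P[]/eqP->;
   rewrite inE ?nf23 ?nf12.
Qed.

Definition sort3 (t : word3) : word3 :=
  let: (x, y, z) := t in
  if x <= y then if y <= z then (x, y, z) else if x <= z then (x, z, y) else (z, x, y)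
  else if x <= z then (y, x, z) else if y <= z then (y, z, x) else (z, y, x).

Lemma nondecr_sort3 t : nondecr (sort3 t).
Proof.
by case: t => [[x y] z] /=; do !case: ifP => /=; lia.
Qed.

Lemma sort3_perm t x y z : sort3 t = (x, y, z) ->
  t \in [:: (x, y, z); (x, z, y); (y, z, x); (y, x, z); (z, x, y); (z, y, x)].
Proof.
by case: t => [[a b] c] /=; rewrite !inE; do !case: ifP => _; case=> <- <- <-;
   rewrite eqxx ?orbT.
Qed.

Lemma card_sort3 x y z :
  #|[set t | sort3 t == (x, y, z)]| <=
    if repeats (x, y, z) then if (x == y) && (y == z) then 1 else 3 else 6.
Proof.
have sub (s : seq word3) : (forall t, sort3 t = (x, y, z) -> t \in s) ->
    #|[set t | sort3 t == (x, y, z)]| <= size s.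
  move=> sub; apply: leq_trans (card_size s); apply: subset_leq_card.
  by apply/subsetP=> t; rewrite inE => /eqP/sub.
case: ifP => [|_]; last exact: (sub [:: _; _; _; _; _; _] (fun t => @sort3_perm t x y z)).
rewrite /=; case: (eqVneq x y) sub => [<- | _] sub; last move/eqP=> yz; rewrite /=.
  case: (eqVneq x z) sub => [<- | _] sub _.
    by apply: (sub [:: (x, x, x)]) => t /sort3_perm; rewrite !inE !orbb.
  apply: (sub [:: (x, x, z); (x, z, x); (z, x, x)]) => t /sort3_perm.
  by rewrite !inE; case/or4P=> [|||/or3P[]] ->; rewrite ?orbT.
rewrite -yz in sub *; apply: (sub [:: (x, y, y); (y, x, y); (y, y, x)]) => t.
by move/sort3_perm; rewrite !inE; case/or4P=> [|||/or3P[]] ->; rewrite ?orbT.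
Qed.

(** A class without repetitions has three distinct last letters, by
[tails_uniq], so at least six words by [card_tails]. *)
Lemma card_sort3_class m : nondecr m -> #|[set t | sort3 t == m]| <= #|class m|.
Proof.
case: m => [[x y] z] ndm; apply: leq_trans (card_sort3 x y z) _.
have nfm := nf_id ndm; case: ifP => [rm | /negbT nr].
  case: ifP => [_ | /negbT]; first by rewrite card_gt0; apply/set0Pn; exists (x, y, z); rewrite inE.
  by rewrite negb_and; apply: card_class_repeats.
have nr' : ~~ repeats (nf (x, y, z)) by rewrite nfm.
apply: leq_trans (card_tails nr'); rewrite (leq_mul2l 2 3) /=.
have tc : (x, y, z) \in class (x, y, z) by rewrite inE.
apply/card_geqP; exists [:: z; R y z; R (R x y) z].
split=> //; first exact: tails_uniq nr' tc.
move=> w; rewrite !in_cons in_nil orbF => /or3P[]/eqP->; apply/imsetP.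
- by exists (x, y, z).
- by exists (r23 (x, y, z)); rewrite ?class23.
by exists (r23 (r12 (x, y, z))); rewrite ?class23 ?class12.
Qed.

(** The inequalities of [card_sort3_class] add up to an equality, since the fibres
of [sort3] and those of [nf] both partition the set of all words. *)
Lemma card_class m : nondecr m -> #|class m| = #|[set t | sort3 t == m]|.
Proof.
move=> ndm.
have count (f : word3 -> word3) : (forall t, nondecr (f t)) ->
    \sum_(m | nondecr m) #|[set t | f t == m]| = #|{: word3}|.
  move=> ndf; rewrite -[RHS]sum1_card [RHS](partition_big f nondecr) //.
  by apply: eq_bigr => w _; rewrite -sum1_card; apply: eq_bigl => t; rewrite inE.
have := @leqif_sum _ nondecr
  (fun m => #|[set t | sort3 t == m]| == #|[set t | nf t == m]|)
  (fun m => #|[set t | sort3 t == m]|) (fun m => #|[set t | nf t == m]|).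
case=> [w ndw | _].
  by split=> //; have := card_sort3_class ndw; rewrite /class nf_id.
rewrite (count _ nondecr_sort3) (count _ nf_nondecr) eqxx.
by move/esym/forall_inP/(_ m ndm)/eqP->; rewrite /class nf_id.
Qed.

Lemma card_class_le t : #|class t| <= if repeats (nf t) then 3 else 6.
Proof.
have -> : class t = class (nf t) by apply/setP=> s; rewrite !inE (nf_id (nf_nondecr t)).
rewrite card_class //; move: (nf t) => [[x y] z].
by apply: leq_trans (card_sort3 x y z) _; do !case: ifP.
Qed.

Lemma class3_mem t a b c d : #|class t| <= 3 -> uniq [:: a; b; c] ->
    {subset [:: d; a; b; c] <= class t} -> d \in [:: a; b; c].
Proof.
move=> le3 u3 sub; apply: contraTT le3 => nd; rewrite -ltnNge.
by apply/card_geqP; exists [:: d; a; b; c]; split=> //; rewrite cons_uniq nd.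
Qed.

(** A class of three words is a path for the moves [r12] and [r23], ending at the
two words that one of these moves fixes.  If x = y, the word is an end, and
the third word of the path is fixed by [r23]; otherwise x != y and y != z, and
the word is the middle one, with both neighbours fixed. *)
Lemma R_braid_repeats x y z : y != z -> #|class (x, y, z)| <= 3 ->
  R (R x y) z = R (R x (L y z)) (R y z).
Proof.
set t := (x, y, z) => yz le3; have tt : t \in class t by rewrite inE.
have inC := (class12, class23, tt).
have gt : r23 t != t by rewrite r23_fix.
have [exy | xy] := eqVneq x y.
  have ft : r12 t = t by apply/eqP; rewrite r12_fix exy.
  have fgt : r12 (r23 t) != r23 t by rewrite [r23 t]/= r12_fix eq_sym exy L_eq.
  have u3 := three_words r12K ft gt fgt.
  have := @class3_mem t _ _ _ (r23 (r12 (r23 t))) le3 u3.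
  have sub : {subset [:: r23 (r12 (r23 t)); t; r23 t; r12 (r23 t)] <= class t}.
    by move=> w; rewrite !in_cons in_nil orbF => /or4P[]/eqP->; rewrite ?inC.
  move=> /(_ sub); rewrite !in_cons in_nil orbF => /or3P[/eqP e|/eqP e|].
  - by case/negP: fgt; rewrite -(inj_eq (inv_inj r23K)) e r23K.
  - case/negP: gt; rewrite -(inj_eq (inv_inj r12K)) ft.
    by rewrite (inv_inj r23K e).
  by rewrite /t exy [r12 _]/= r23_fix Rid => /eqP->; rewrite Rid.
have ft : r12 t != t by rewrite r12_fix.
have fgt : r12 t != r23 t by rewrite /= !xpair_eqE L_eq (negPf xy).
have u3 : uniq [:: t; r12 t; r23 t].
  by rewrite /= !inE negb_or andbT -/(r12 t) -/(r23 t) ![t == _]eq_sym gt ft fgt.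
have sub12 : {subset [:: r12 (r23 t); t; r12 t; r23 t] <= class t}.
  by move=> w; rewrite !in_cons in_nil orbF => /or4P[]/eqP->; rewrite ?inC.
have sub23 : {subset [:: r23 (r12 t); t; r12 t; r23 t] <= class t}.
  by move=> w; rewrite !in_cons in_nil orbF => /or4P[]/eqP->; rewrite ?inC.
have := class3_mem le3 u3 sub12; have := class3_mem le3 u3 sub23.
rewrite !in_cons in_nil !orbF => /or3P[/eqP e|e|/eqP/(inv_inj r23K)/eqP].
- by case/eqP: fgt; rewrite -{2}e r23K.
- case/or3P=> [/eqP e'|/eqP/(inv_inj r12K)/eqP|e'].
  + by case/eqP: fgt; rewrite -{1}e' r12K.
  + by rewrite (negPf gt).
  rewrite [r12 _]/= r23_fix in e; rewrite [r23 _]/= r12_fix in e'.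
  by rewrite (eqP e) -(eqP e') !Rid {1}(eqP e') RK.
by rewrite (negPf ft).
Qed.

(** The two sides are the last letters of words of the same class.  In a class of
six words without repetitions there are only three last letters, by
[card_tails], and both sides differ from z and R y z, by [tails_uniq]. *)
Lemma R_braid x y z : R (R x y) z = R (R x (L y z)) (R y z).
Proof.
have [<- | yz] := eqVneq y z; first by rewrite Lid Rid.
set t := (x, y, z); have := card_class_le t.
case: ifP => [_ le3 | /negbT nr le6]; first exact: R_braid_repeats.
have tt : (x, y, z) \in class t by rewrite inE.
have tt' : (x, L y z, R y z) \in class t by rewrite -[(x, _, _)]/(r23 t) class23.
have := tails_uniq nr tt; have := tails_uniq nr tt'; rewrite RK.
move: (leq_trans (card_tails nr) le6); rewrite (leq_mul2l 2 _ 3) /=.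
set Tl := imset _ _ => le3.
have inT c d e : (c, d, e) \in class t -> e \in Tl by move=> ?; apply/imsetP; exists (c, d, e).
have z1 := inT _ _ _ tt; have z2 := inT _ _ _ tt'.
have step c d e : (c, d, e) \in class t -> R (R c d) e \in Tl.
  by move=> ct; apply: (inT (L c d) (L (R c d) e)); rewrite -[(_, _, _)]/(r23 (r12 (c, d, e))) class23 class12.
have z3 := step _ _ _ tt; have z4 := step _ _ _ tt'.
rewrite /= !inE !negb_or !andbT => /andP[/andP[_ n1] n2] /andP[/andP[n3 n4] n5].
apply/eqP; apply: contraLR le3 => n6; rewrite -ltnNge.
apply/card_geqP; exists [:: z; R y z; R (R x y) z; R (R x (L y z)) (R y z)].
split=> //; first by rewrite /= !inE !negb_or n1 n2 n3 n4 n5 n6.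
by move=> w; rewrite !in_cons in_nil orbF => /or4P[]/eqP->.
Qed.

End NormalForm.
End OrderedInvolution.

(** * The involution of a set of quadratic relations *)

(** An ascent is u_ij for exactly one pair (i, j), and it is sent to the descent
x_j x_i. *)
Lemma quad_involution n (u : 'I_n -> 'I_n -> seq 'I_n) : cond1 u -> cond2 u ->
  exists L R, ordered_involution L R /\
    forall i j : 'I_n, i < j -> u i j = [:: L j i; R j i].
Proof.
move=> h1 h2.
pose src (x y : 'I_n) := [pick ij : 'I_n * 'I_n | (ij.1 < ij.2) && (u ij.1 ij.2 == [:: x; y])].
pose L (x y : 'I_n) := if y < x then head x (u y x)
  else if x < y then if src x y is Some ij then ij.2 else x else x.
pose R (x y : 'I_n) := if y < x then last x (u y x)
  else if x < y then if src x y is Some ij then ij.1 else y else y.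
have uLR (i j : 'I_n) : i < j -> u i j = [:: L j i; R j i].
  by move=> ij; rewrite /L /R ij; have [a [b [-> _ _]]] := h1 i j ij.
have down (x y : 'I_n) : y < x -> L x y < R x y /\ L x y < x.
  move=> yx; have [a [b [e ab ax]]] := h1 y x yx.
  by move: e; rewrite (uLR _ _ yx) => -[-> ->].
have up (x y : 'I_n) : x < y ->
    R x y < L x y /\ u (R x y) (L x y) = [:: x; y].
  move=> xy; have [[i j] [[/= ij e] _]] := h2 x y xy.
  rewrite /L /R [y < x]ltnNge (ltnW xy) xy /src; case: pickP => [[i' j'] /=|/(_ (i, j))].
    by case/andP=> ? /eqP.
  by rewrite /= ij e eqxx.
have diag (x : 'I_n) : L x x = x /\ R x x = x by rewrite /L /R ltnn.
have down_up (x y : 'I_n) : y < x -> L (L x y) (R x y) = x /\ R (L x y) (R x y) = y.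
  move=> yx; have [ab _] := down x y yx; have [lt e] := up _ _ ab.
  have [[i j] [_ uniq]] := h2 _ _ ab.
  have e1 := uniq (y, x) (conj yx (uLR _ _ yx)).
  by have := uniq (_, _) (conj lt e); rewrite e1 => -[].
have up_down (x y : 'I_n) : x < y -> L (L x y) (R x y) = x /\ R (L x y) (R x y) = y.
  by move=> xy; have [lt] := up x y xy; rewrite (uLR _ _ lt) => -[].
have inv (x y : 'I_n) : L (L x y) (R x y) = x /\ R (L x y) (R x y) = y.
  have [/up_down//|/down_up//|/val_inj->] := ltngtP x y.
  by have [eL eR] := diag y; rewrite eL eR.
exists L, R; split=> //; split=> [x y|x y|x|x|x y|x y|x y].
- by case: (inv x y).
- by case: (inv x y).
- by case: (diag x).
- by case: (diag x).
- by case/down.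
- by case/down.
by case/up.
Qed.

Lemma quad_confluent n (u : 'I_n -> 'I_n -> seq 'I_n) L R :
    (forall i j : 'I_n, i < j -> u i j = [:: L j i; R j i]) ->
  cond3 u -> confluent L R.
Proof.
move=> uLR h3 x y z zy yx.
pose s3 (t : word3 n) : seq 'I_n := let: (a, b, c) := t in [:: a; b; c].
have s3_inj : injective s3 by move=> [[? ?] ?] [[? ?] ?] [-> -> ->].
have step t w : rstep (quad_rel u) (s3 t) w ->
    exists2 t', w = s3 t' & descends L R t t'.
  case: t => [[a b] c] st; have [w0 e0] : exists w0, w0 = s3 (a, b, c) by eexists.
  rewrite -e0 in st; case: st e0 => p q _ _ [i [j [ij -> ->]]].
  rewrite (uLR _ _ ij); case: p => [|p [|p' p2]] /= [].
  - move=> <- <- ->; exists (r12 L R (j, i, c)) => //; exact: Descends12.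
  - move=> -> <- <- ->; exists (r23 L R (a, j, i)) => //; exact: Descends23.
  by move=> _ _ /(congr1 size); rewrite size_cat /= !addnS.
have chain w0 w : reduces (quad_rel u) w0 w -> forall t, w0 = s3 t ->
    exists2 t', w = s3 t' & clos_refl_trans _ (descends L R) t t'.
  elim=> [{}w0 {}w st t e|{}w0 t ->|w1 w2 w3 _ IH1 _ IH2 t].
  - rewrite e in st; have [t' -> tt'] := step _ _ st.
    by exists t' => //; apply: rt_step.
  - by exists t => //; apply: rt_refl.
  case/IH1=> t1 /IH2[t2 -> t12] tt1; exists t2 => //.
  exact: rt_trans tt1 t12.
have [a [b [c [ab bc red1 red2]]]] := h3 z y x zy yx.
rewrite !uLR // in red1 red2.
have [t1 e1 c1] := chain _ _ red1 (r12 L R (x, y, z)) erefl.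
have [t2 e2 c2] := chain _ _ red2 (r23 L R (x, y, z)) erefl.
have m1 : t1 = (a, b, c) by exact: s3_inj.
have m2 : t2 = (a, b, c) by exact: s3_inj.
by rewrite m1 in c1; rewrite m2 in c2; exists (a, b, c); split; rewrite //= ab.
Qed.

(** * Contents of words *)

Definition cm_of_seq (I : choiceType) (l : seq I) : {cmonom I} :=
  \big[mmul/mone]_(i <- l) ucm i.

Lemma cm_of_seqE (I : choiceType) (l : seq I) i : cm_of_seq l i = count_mem i l.
Proof.
elim: l => [|j l IH]; first by rewrite /cm_of_seq big_nil cm1.
by rewrite /cm_of_seq big_cons cmM cmU -/(cm_of_seq l) IH.
Qed.

Lemma cm_of_seq_perm (I : choiceType) (l l' : seq I) :
  cm_of_seq l = cm_of_seq l' <-> perm_eq l l'.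
Proof.
split=> [e | /permP e].
  by apply/allP=> i _ /=; rewrite -!cm_of_seqE e.
by apply/eqP/cmP=> i; rewrite !cm_of_seqE e.
Qed.

Lemma cm_of_seq_surj n (m : {cmonom 'I_n}) : exists l, cm_of_seq l = m.
Proof.
exists (flatten [seq nseq (m i) i | i <- enum 'I_n]); apply/eqP/cmP=> j.
rewrite cm_of_seqE count_flatten -map_comp sumnE big_map big_enum /=.
rewrite (bigD1 j) //= big1 ?addn0 => [|i /negPf ne]; rewrite count_nseq /=.
  by rewrite eqxx mul1n.
by rewrite ne.
Qed.

Lemma presented_prod (X : choiceType) (rel : seq X -> seq X -> Prop) (w : seq X) :
  \pi_(presented rel)%qT w = (\prod_(i <- w) pgen rel i)%g.
Proof.
elim: w => [|x w IH]; first by rewrite big_nil.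
by rewrite big_cons -IH; exact/esym/pmul_pi.
Qed.

Section Content.

Variables (n : nat) (L R : 'I_n -> 'I_n -> 'I_n) (u : 'I_n -> 'I_n -> seq 'I_n).
Hypothesis LR : ordered_involution L R.
Hypothesis uLR : forall i j : 'I_n, i < j -> u i j = [:: L j i; R j i].
Hypothesis R_perm : forall x, injective (R^~ x).
Hypothesis R_full : forall x e, exists y, R y x = e.
Hypothesis braid : forall x y z, R (R x y) z = R (R x (L y z)) (R y z).

Local Notation cong := (pcong (quad_rel u)).

(** [foldl R x s] is the letter that comes out on the right when x is pushed
through s. *)
Fixpoint content (s : seq 'I_n) : seq 'I_n :=
  if s is x :: s' then foldl R x s' :: content s' else [::].

Lemma size_content s : size (content s) = size s.
Proof. by elim: s => //= x s ->. Qed.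

Lemma content_cat s t :
  content (s ++ t) = [seq foldl R x t | x <- content s] ++ content t.
Proof. by elim: s => //= x s ->; rewrite foldl_cat. Qed.

Lemma foldl_rstep s t x :
  rstep (quad_rel u) s t -> foldl R x s = foldl R x t.
Proof.
case=> p q _ _ [i [j [ij -> ->]]]; rewrite uLR // !foldl_cat /=.
by rewrite braid.
Qed.

Lemma content_rstep s t :
  rstep (quad_rel u) s t -> perm_eq (content s) (content t).
Proof.
case=> p q l r lr; have e x : foldl R x (l ++ q) = foldl R x (r ++ q).
  by apply: foldl_rstep; apply: (@RStep _ _ [::]).
rewrite !content_cat (eq_map e) perm_cat2l perm_cat2r.
case: lr => i [j [ij -> ->]]; rewrite uLR //= (inv_R LR).
by rewrite (perm_catC [:: _] [:: _]).
Qed.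

Lemma content_pcong s t : cong s t -> perm_eq (content s) (content t).
Proof.
elim=> [? ?|//|? ? _|? ? ? _ h1 _ h2]; first exact: content_rstep.
  by rewrite perm_sym.
exact: perm_trans h1 h2.
Qed.

Lemma pcong_swap x y : cong [:: x; y] [:: L x y; R x y].
Proof.
have dn (i j : 'I_n) : i < j -> cong [:: j; i] [:: L j i; R j i].
  move=> ij; apply: rst_step.
  apply: (@RStep _ _ [::] [::] [:: j; i] [:: L j i; R j i]).
  by exists i, j; split=> //; rewrite uLR.
have [lt|/dn//|/val_inj->] := ltngtP x y.
  apply: rst_sym; have := dn _ _ (ascent_LR LR lt).
  by rewrite (inv_L LR) (inv_R LR).
by rewrite (diag_L LR) (diag_R LR); apply: rst_refl.
Qed.

Lemma push_right x s : exists s', cong (x :: s) (rcons s' (foldl R x s)).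
Proof.
elim: s x => [|y s IH] x; first by exists [::]; apply: rst_refl.
have [s' h] := IH (R x y); exists (L x y :: s').
apply: rst_trans (pcong_ctx [::] s (pcong_swap x y)) _.
by have := pcong_ctx [:: L x y] [::] h; rewrite !cats0.
Qed.

Lemma content_last s i : i \in content s -> exists s', cong s (rcons s' i).
Proof.
elim: s => //= x s IH; rewrite in_cons => /predU1P[-> | /IH[s' h]].
  exact: push_right.
by exists (x :: s'); have := pcong_ctx [:: x] [::] h; rewrite !cats0.
Qed.

Lemma content_rcons s i :
  content (rcons s i) = rcons [seq R x i | x <- content s] i.
Proof. by rewrite -cats1 content_cat cats1. Qed.

(** Bring the first letter i of the content of one word to the right end of both
words.  Removing it there removes i from the contents and applies the inverse of
x |-> R x i to the other letters, so the shorter words again have equal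
contents. *)
Lemma content_inj s t : perm_eq (content s) (content t) -> cong s t.
Proof.
have [m] := ubnP (size s); elim: m s t => // m IH [|x s] t.
  move=> _ /perm_size; rewrite !size_content; case: t => // _.
  exact: rst_refl.
move=> le_m pst; set i := foldl R x s.
have [s' hs] : exists s', cong (x :: s) (rcons s' i) by exact: push_right.
have [t' ht] : exists t', cong t (rcons t' i).
  by apply: content_last; rewrite -(perm_mem pst) mem_head.
apply: rst_trans (hs) _; apply: rst_trans _ (rst_sym _ _ _ _ ht).
rewrite -!cats1; apply: (pcong_ctx [::]); apply: IH.
  have /perm_size := content_pcong hs; rewrite !size_content size_rcons /= => -[<-].
  by [].
apply: (perm_map_inj (@R_perm i)); rewrite -(perm_cat2r [:: i]) !cats1 -!content_rcons.
apply: perm_trans (content_pcong ht); apply: perm_trans (pst).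
by rewrite perm_sym; exact: content_pcong.
Qed.

Lemma foldl_R_full s e : exists x, foldl R x s = e.
Proof.
elim/last_ind: s e => [|s i IH] e; first by exists e.
have [y <-] := R_full i e; have [x <-] := IH y.
by exists x; rewrite -cats1 foldl_cat.
Qed.

Lemma content_surj l : exists s, content s = l.
Proof.
elim: l => [|i l [s <-]]; first by exists [::].
by have [x <-] := foldl_R_full s i; exists (x :: s).
Qed.

End Content.

(** * The theorem *)

Theorem mainTheorem3 (n : nat) (u : 'I_n -> 'I_n -> seq 'I_n)
    (h1 : cond1 u) (h2 : cond2 u) (h3 : cond3 u) :
  left_Itype (pgen (quad_rel u)).
Proof.
have [L [R [LR uLR]]] := quad_involution h1 h2.
have [nf nfP] := normal_form_exists LR (quad_confluent uLR h3).
have R_perm := R_inj LR nfP.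
have R_full := R_surj LR nfP.
have braid := R_braid LR nfP.
set S := presented (quad_rel u).
pose word (q : S) : seq 'I_n := repr q.
have wordK (q : S) : \pi_S%qT (word q) = q by exact: reprK.
pose V (q : S) : {cmonom 'I_n} := cm_of_seq (content R (word q)).
have V_pi w : V (\pi_S%qT w) = cm_of_seq (content R w).
  apply/cm_of_seq_perm/(content_pcong LR uLR braid)/presentedP.
  exact: wordK.
have V_inj : injective V.
  move=> p q /cm_of_seq_perm/(content_inj LR uLR R_perm braid)/presentedP.
  by rewrite !wordK.
have V_surj a : exists q, V q == a.
  have [l <-] := cm_of_seq_surj a; have [w <-] := content_surj R_full l.
  by exists (\pi_S%qT w); rewrite V_pi.
pose v a : S := xchoose (V_surj a).
have vK a : V (v a) = a by apply/eqP; exact: (xchooseP (V_surj a)).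
have V_mul x (q : S) :
    V (pgen (quad_rel u) x * q)%g = mmul (ucm (foldl R x (word q))) (V q).
  have -> : (pgen (quad_rel u) x * q)%g = \pi_S%qT (x :: word q).
    by rewrite -{1}(wordK q); exact: pmul_pi.
  by rewrite V_pi /cm_of_seq big_cons.
split.
  by move=> s; exists (word s); rewrite -presented_prod wordK.
exists v; split.
- by exists V => [a | q]; rewrite ?vK //; apply: V_inj; rewrite vK.
- by apply: V_inj; rewrite vK (V_pi [::]) /cm_of_seq big_nil.
move=> a; apply/classical_sets.seteqP; split=> _ [i _ <-] /=.
  have [x ex] := foldl_R_full R_full (word (v a)) i; exists x => //.
  by apply: V_inj; rewrite V_mul !vK ex.
exists (foldl R i (word (v a))) => //.
by apply: V_inj; rewrite V_mul !vK.
Qed.
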